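(* Let $n\ge 1$, let $\mathcal A\subseteq2^{[n]}$ be increasing and let $0\leq p\leq q\leq1$. Then $$\mu_q(\mathcal A)\geq\Theta_{p,q}(\mu_p(\mathcal A)).$$ If $0<p<q<1$, then $$\mu_q(\mathcal A)\geq\mu_p(\mathcal A)^{\frac{\log q}{\log p}},$$ and, for nonempty $\mathcal A$ (and $0<p<q<1$), equality in this last inequality holds if and only if $\mathcal A=\{A\subseteq[n]:S\subseteq A\}$ for some $S\subseteq[n]$.
   Context: $[n]=\{1,\ldots,n\}$ and $2^{[n]}$ is its power set. A family $\mathcal A\subseteq 2^{[n]}$ is increasing if $A\in\mathcal A$ and $A\subseteq B\subseteq[n]$ imply $B\in\mathcal A$. For $0\le p\le 1$, $\mu_p(\mathcal A)=\sum_{A\in\mathcal A}p^{|A|}(1-p)^{n-|A|}$ (with $0^0=1$). For $0<p\leq q<1$ the function $\Theta_{p,q}:[0,1]\to[0,1]$ is $$\Theta_{p,q}(x)=\begin{cases} x^{\frac{\log q}{\log p}}, &0\leq x\leq p^2,\\ q\left[1-\left(1-\frac{x}{p}\right)^{\frac{\log(1-q)}{\log(1-p)}}\right], &p^2\leq x\leq p,\\ 1-(1-x)^{\frac{\log(1-q)}{\log(1-p)}}, &p\leq x\leq1\end{cases}$$ (the formulas agree at $x=p^2$ and $x=p$). Endpoint conventions: $\Theta_{0,q}(x)=\mathbf 1_{\{x>0\}}$ for $0<q\leq1$; $\Theta_{p,1}(x)=\mathbf 1_{\{x>0\}}$ for $0<p<1$; $\Theta_{0,0}(x)=\Theta_{1,1}(x)=x$.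 Here $\log$ is the natural logarithm. *)

(* Defs.v *)
From mathcomp Require Import all_boot all_order all_algebra.
From mathcomp Require Import reals exp.
Set Implicit Arguments.
Unset Strict Implicit.
Unset Printing Implicit Defensive.

Import Order.TTheory GRing.Theory Num.Theory.
Local Open Scope ring_scope.

Definition increasing (n : nat) (F : {set {set 'I_n}}) : Prop :=
  forall A B : {set 'I_n}, A \in F -> A \subset B -> B \in F.

(* [0 ^+ 0 = 1], so this is also the intended measure at [p = 0] and [p = 1]. *)
Definition mu (R : realType) (n : nat) (p : R) (F : {set {set 'I_n}}) : R :=
  \sum_(A in F) p ^+ #|A| * (1 - p) ^+ (n - #|A|).

(* Meaningful for [0 <= p <= q <= 1] and [0 <= x <= 1], where every base of a
   real power below is nonnegative. The closed pieces overlap only at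
   [x = p ^+ 2] and [x = p], where the two formulas agree. *)
Definition Theta (R : realType) (p q x : R) : R :=
  if (p == 0) && (q == 0) || (p == 1) && (q == 1) then x
  else if (p == 0) || (q == 1) then (0 < x)%R%:R
  else if x <= p ^+ 2 then x `^ (ln q / ln p)
  else if x <= p then q * (1 - (1 - x / p) `^ (ln (1 - q) / ln (1 - p)))
  else 1 - (1 - x) `^ (ln (1 - q) / ln (1 - p)).

(* Main.v *)
(** Put a = log q / log p, b = log(1-q) / log(1-p), g(x) = x^a and
    h(x) = 1 - (1-x)^b. Conditioning on one coordinate writes mu_p of an
    increasing family as (1-p)x + py with x <= y, so mu_q >= phi(mu_p) follows
    by induction for every phi fixing 0 and 1 such that
      phi((1-p)x + py) <= (1-q) phi(x) + q phi(y)   for 0 <= x <= y <= 1.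
    For phi = g this is g(px) + g(x+py-px) <= g(x) + g(py), since g(p) = q: a
    majorization inequality for a concave function, which is strict unless
    x = 0 or x = y; strictness forces the equality families to be subcubes.
    Convexity of t^b gives it in the same way for h and for x |-> q h(x/p).
    These glue to Theta because g >= h on [0,p] and g <= h on [p,1], so that
    each piece of Theta is dominated by Theta on the range where it is used. *)
Require Import Defs.
From mathcomp Require Import classical_sets topology normedtype sequences.
From mathcomp Require Import derive realfun.
From mathcomp Require Import all_boot all_order all_algebra.
From mathcomp Require Import reals exp.
From mathcomp Require Import ring lra.
Set Implicit Arguments.
Unset Strict Implicit.
Unset Printing Implicit Defensive.

Import Order.TTheory GRing.Theory Num.Theory.
Import numFieldNormedType.Exports.
Local Open Scope ring_scope.

(** * Tangent, Jensen and majorization inequalities for powers, and the crossing of x^a with 1 -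
    (1-x)^b *)

Section PowerInequalities.
Local Open Scope classical_set_scope.
Variable R : realType.
Implicit Types (a b c d l p q r t u v x y z : R).

(** With s = ln t, average the strict bounds exp(-as) > 1 - as and exp((1-a)s) > 1 + (1-a)s with
    weights 1 - a and a: the linear terms cancel. Multiplying by exp(as) = t^a gives the claim. *)
Lemma powR_lt_tangent a t : 0 < a < 1 -> 0 <= t -> t != 1 ->
  t `^ a < 1 + a * (t - 1).
Proof.
move=> /andP[a0 a1]; rewrite le_eqVlt => /predU1P[<- _|t0 t1].
  by rewrite powR0 ?gt_eqF//; lra.
have s0 : ln t != 0 by rewrite ln_eq0.
have e1 : 1 + (1 - a) * ln t < expR ((1 - a) * ln t).
  by apply: expR_gt1Dx; rewrite mulf_neq0// subr_eq0 gt_eqF.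
have e2 : 1 + - a * ln t < expR (- a * ln t).
  by apply: expR_gt1Dx; rewrite mulf_neq0// oppr_eq0 gt_eqF.
have tE : t = expR (a * ln t) * expR ((1 - a) * ln t).
  by rewrite -expRD -mulrDl addrC subrK mul1r lnK.
have oneE : expR (a * ln t) * expR (- a * ln t) = 1.
  by rewrite -expRD mulNr subrr expR0.
have -> : t `^ a = expR (a * ln t) by rewrite /powR gt_eqF.
have k0 := expR_gt0 (a * ln t).
have {e1 e2} : 1 < (1 - a) * expR (- a * ln t) + a * expR ((1 - a) * ln t).
  have := mulr_gt0 a0 (_ : 0 < expR ((1 - a) * ln t) - (1 + (1 - a) * ln t)).
  have := mulr_gt0 (_ : 0 < 1 - a) (_ : 0 < expR (- a * ln t) - (1 - a * ln t)).
  by rewrite !subr_gt0 -mulNr => /(_ a1 e2) h2 /(_ e1) h1; lra.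
rewrite -subr_gt0 => /(mulr_gt0 k0).
have -> : forall k k1 k2 : R, k * ((1 - a) * k1 + a * k2 - 1) =
   (1 - a) * (k * k1) + a * (k * k2) - k by move=> *; ring.
by rewrite oneE -tE; lra.
Qed.

Lemma powR_lt_tangent_at a c x : 0 < a < 1 -> 0 < c -> 0 <= x -> x != c ->
  x `^ a < c `^ a + a * c `^ a / c * (x - c).
Proof.
move=> a01 c0 x0 xc.
have xE : x = c * (x / c) by rewrite mulrCA divff ?gt_eqF// mulr1.
have := powR_lt_tangent a01 (divr_ge0 x0 (ltW c0)) (_ : x / c != 1).
rewrite -(inj_eq (mulfI (lt0r_neq0 c0))) -xE mulr1 => /(_ xc).
rewrite -(ltr_pM2l (powR_gt0 a c0)) -powRM ?(ltW c0) ?divr_ge0 ?(ltW c0)// -xE.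
move=> /lt_le_trans; apply; rewrite le_eqVlt; apply/orP; left; apply/eqP.
by field; rewrite gt_eqF.
Qed.

(** Both points lie strictly below the tangent at their mean [c]; in the weighted sum of the two
    tangent bounds the slope terms cancel. *)
Lemma powR_jensen_lt a l x y : 0 < a < 1 -> 0 < l < 1 ->
  0 <= x -> 0 <= y -> x != y ->
  l * x `^ a + (1 - l) * y `^ a < (l * x + (1 - l) * y) `^ a.
Proof.
move=> a01 /andP[l0 l1] x0 y0 xy; set c := l * x + (1 - l) * y.
have c0 : 0 < c.
  have h1 : 0 <= l * x by rewrite mulr_ge0// ltW.
  have h2 : 0 <= (1 - l) * y by rewrite mulr_ge0// subr_ge0 ltW.
  rewrite lt_neqAle [X in _ && X]addr_ge0// andbT eq_sym.
  apply: contra_neq xy; rewrite /c => ceq0.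
  have /eqP : l * x = 0 by lra.
  have /eqP : (1 - l) * y = 0 by lra.
  by rewrite !mulf_eq0 subr_eq0 (gt_eqF l0) (gt_eqF l1)/= => /eqP -> /eqP ->.
have xc : x != c.
  rewrite -subr_eq0 (_ : x - c = (1 - l) * (x - y)); last by rewrite /c; ring.
  by rewrite mulf_neq0 ?subr_eq0// gt_eqF.
have yc : y != c.
  rewrite -subr_eq0 (_ : y - c = l * (y - x)); last by rewrite /c; ring.
  by rewrite mulf_neq0 ?subr_eq0 1?eq_sym// lt_eqF.
have l1' : 0 < 1 - l by rewrite subr_gt0.
have h1 := powR_lt_tangent_at a01 c0 x0 xc.
have h2 := powR_lt_tangent_at a01 c0 y0 yc.
rewrite -(ltr_pM2l l0) in h1; rewrite -(ltr_pM2l l1') in h2.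
move: (c `^ a) (a * _ / c) h1 h2 => k m h1 h2; move: (ltrD h1 h2); rewrite /c.
by have -> : l * (k + m * (x - (l * x + (1 - l) * y))) +
  (1 - l) * (k + m * (y - (l * x + (1 - l) * y))) = k by ring.
Qed.

Lemma powR_jensen_le a l x y : 0 < a <= 1 -> 0 <= l <= 1 ->
  0 <= x -> 0 <= y ->
  l * x `^ a + (1 - l) * y `^ a <= (l * x + (1 - l) * y) `^ a.
Proof.
move=> /andP[a0]; rewrite le_eqVlt => /predU1P[->|a1] /andP[l0 l1] x0 y0.
  by rewrite !powRr1// addr_ge0// mulr_ge0// subr_ge0.
have [->|xy] := eqVneq x y.
  by rewrite -!mulrDl addrC subrK !mul1r.
have [->|lN0] := eqVneq l 0; first by rewrite !mul0r !add0r subr0 !mul1r.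
have [->|lN1] := eqVneq l 1; first by rewrite subrr !mul0r !addr0 !mul1r.
by apply/ltW/powR_jensen_lt; rewrite ?a0//; apply/andP; split;
  rewrite lt_neqAle ?lN1// eq_sym lN0.
Qed.

(** This is the concave case for the exponent 1/b at the points x^b and y^b, raised to the power
    b. *)
Lemma powR_jensen_ge b l x y : 1 <= b -> 0 <= l <= 1 -> 0 <= x -> 0 <= y ->
  (l * x + (1 - l) * y) `^ b <= l * x `^ b + (1 - l) * y `^ b.
Proof.
move=> b1 l01 x0 y0; have b0 : 0 < b by apply: lt_le_trans b1.
have := @powR_jensen_le b^-1 l (x `^ b) (y `^ b).
rewrite -!powRrM divff ?gt_eqF// !powRr1// invr_gt0 b0 invf_le1// b1 !powR_ge0.
move=> /(_ isT l01 isT isT); case/andP: l01 => l0 l1.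
have s0 : 0 <= l * x + (1 - l) * y by rewrite addr_ge0// mulr_ge0// subr_ge0.
move=> /(ge0_ler_powR (ltW b0)); rewrite !nnegrE => /(_ s0 (powR_ge0 _ _)).
rewrite -powRrM mulVf ?gt_eqF// powRr1// addr_ge0// mulr_ge0 ?powR_ge0//.
by rewrite subr_ge0.
Qed.

(* The inner pair is [b] and [x + d - b], the outer pair [x] and [d]. *)
Lemma powR_majorization_lt a x b d : 0 < a < 1 -> 0 <= x -> x < b -> b < d ->
  x `^ a + d `^ a < b `^ a + (x + d - b) `^ a.
Proof.
move=> a01 x0 xb bd; have dx : 0 < d - x by lra.
(* [b] is the mean of [x] and [d] with weights l and 1 - l, and [x + d - b] is the mean with the
   weights exchanged. The two Jensen inequalities add up to the claim. *)
pose l := (d - b) / (d - x).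
have l01 : 0 < l < 1.
  by rewrite /l ltr_pdivlMr// ltr_pdivrMr// mul0r mul1r; lra.
have l01' : 0 < 1 - l < 1 by lra.
have d0 : 0 <= d by lra.
have xd : x != d by rewrite lt_eqF; lra.
have h1 := powR_jensen_lt a01 l01 x0 d0 xd.
have h2 := powR_jensen_lt a01 l01' x0 d0 xd.
have bE : l * x + (1 - l) * d = b by rewrite /l; field; rewrite gt_eqF.
have cE : (1 - l) * x + (1 - (1 - l)) * d = x + d - b by rewrite -bE; ring.
by move: h1 h2; rewrite bE cE; lra.
Qed.

Lemma powR_majorization_le a x b d : 0 < a <= 1 -> 0 <= x -> x <= b -> b <= d ->
  x `^ a + d `^ a <= b `^ a + (x + d - b) `^ a.
Proof.
move=> /andP[a0]; rewrite le_eqVlt => /predU1P[->|a1] x0 xb bd.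
  by rewrite !powRr1//; lra.
move: xb; rewrite le_eqVlt => /predU1P[->|xb];
  first by rewrite (addrC b d) addrK.
move: bd; rewrite le_eqVlt => /predU1P[<-|bd]; first by rewrite addrK addrC.
by rewrite ltW// powR_majorization_lt// a0.
Qed.

Lemma powR_majorization_ge a x b d : 1 <= a -> 0 <= x -> x <= b -> b <= d ->
  b `^ a + (x + d - b) `^ a <= x `^ a + d `^ a.
Proof.
move=> a1 x0 xb; rewrite le_eqVlt => /predU1P[<-|bd];
  first by rewrite addrK addrC.
have dx : 0 < d - x by lra.
pose l := (d - b) / (d - x).
have l01 : 0 <= l <= 1.
  by rewrite /l ler_pdivlMr// ler_pdivrMr// mul0r mul1r; lra.
have l01' : 0 <= 1 - l <= 1 by lra.
have d0 : 0 <= d by lra.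
have h1 := powR_jensen_ge a1 l01 x0 d0.
have h2 := powR_jensen_ge a1 l01' x0 d0.
have bE : l * x + (1 - l) * d = b by rewrite /l; field; rewrite gt_eqF.
have cE : (1 - l) * x + (1 - (1 - l)) * d = x + d - b by rewrite -bE; ring.
by move: h1 h2; rewrite bE cE; lra.
Qed.

(** [bipow a b x - 1] is g(x) - h(x), so comparing g with h means comparing [bipow] with 1. *)
Let bipow a b x := x `^ a + (1 - x) `^ b.
Let dbipow a b x := a * x `^ (a - 1) - b * (1 - x) `^ (b - 1).

Lemma is_derive_1Bpow b x : x < 1 ->
  is_derive x 1 (fun y => (1 - y) `^ b) (- (b * (1 - x) `^ (b - 1))).
Proof.
rewrite -subr_gt0 => /(is_derive1_powR b) d2.
have d3 : is_derive x 1 (fun y : R => 1 - y) (-1).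
  have -> : -1 = 0 - 1 :> R by rewrite sub0r.
  exact: is_deriveB (is_derive_cst _ _ _) (is_derive_id _ _).
have := @is_derive1_comp _ (fun y => y `^ b) (fun y => 1 - y) x _ _ d2 d3.
by rewrite mulrN1.
Qed.

Lemma bipow_is_derive a b x : 0 < x < 1 ->
  is_derive x 1 (bipow a b) (dbipow a b x).
Proof.
move=> /andP[x0 x1].
exact: is_deriveD (is_derive1_powR a x0) (is_derive_1Bpow b x1).
Qed.

Lemma bipow_sym a b x : bipow a b x = bipow b a (1 - x).
Proof. by rewrite /bipow subKr addrC. Qed.

Lemma bipow0 a b : a != 0 -> bipow a b 0 = 1.
Proof. by move=> a0; rewrite /bipow powR0// subr0 powR1 add0r. Qed.

Lemma is_derive_continuous (f : R -> R) x d : is_derive x 1 f d ->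
  {for x, continuous f}.
Proof.
by case=> df _; apply/differentiable_continuous/derivable1_diffP.
Qed.

(** Kept apart from [bipow_MVT] because x^a need not be differentiable at 0 when a < 1; only
    continuity is used there. *)
Lemma bipow_MVT0 a b u : 0 < a -> 0 < u < 1 ->
  exists2 c, 0 < c < u & bipow a b u - 1 = dbipow a b c * u.
Proof.
move=> a0 /andP[u0 u1].
have dKP x : x \in `]0, u[%R -> is_derive x 1 (bipow a b) (dbipow a b x).
  rewrite in_itv/= => /andP[x0 xu]; apply: bipow_is_derive.
  by rewrite x0 (lt_trans xu).
have Kc : {within `[0, u]%classic, continuous (bipow a b)}.
  apply/(continuous_within_itvP _ u0); split.
  - by move=> x /dKP /is_derive_continuous.
  - rewrite (@bipow0 a b) ?gt_eqF// -[X in _ --> X]add0r.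
    apply: cvgD; first exact: powR_cvg0.
    have := is_derive_continuous (is_derive_1Bpow b (@ltr01 R)).
    by move=> /cvg_at_right_filter; rewrite subr0 powR1.
  - apply: cvg_at_left_filter.
    by apply: is_derive_continuous (bipow_is_derive a b _); rewrite u0.
have [c] := MVT u0 dKP Kc.
by rewrite in_itv/= => cu; rewrite (@bipow0 a b) ?gt_eqF// subr0; exists c.
Qed.

Lemma bipow_MVT a b u v : 0 < u -> u < v -> v < 1 ->
  exists2 c, u < c < v & bipow a b v - bipow a b u = dbipow a b c * (v - u).
Proof.
move=> u0 uv v1.
have dKP x : u <= x <= v -> is_derive x 1 (bipow a b) (dbipow a b x).
  move=> /andP[x0 xu]; apply: bipow_is_derive.
  by rewrite (lt_le_trans u0)// (le_lt_trans xu).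
have [||c] := @MVT _ (bipow a b) (dbipow a b) u v uv.
- by move=> x; rewrite in_itv/= => /andP[ux xv]; apply: dKP; rewrite !ltW.
- apply: derivable_within_continuous => x; rewrite in_itv/= => /dKP.
  by case.
- by rewrite in_itv/= => ?; exists c.
Qed.

Lemma dbipow_sym a b x : dbipow b a (1 - x) = - dbipow a b x.
Proof. by rewrite /dbipow subKr opprB. Qed.

(** Bound [ln x] and [ln z] by the tangent at [y]; the weights z - y and y - x make the linear terms
    cancel. *)
Lemma ln_concave x y z : 0 < x -> x < y -> y < z ->
  (z - y) * ln x + (y - x) * ln z <= (z - x) * ln y.
Proof.
move=> x0 xy yz; have y0 : 0 < y by lra. have z0 : 0 < z by lra.
have tgt t : 0 < t -> ln t - ln y <= t / y - 1.
  move=> t0; rewrite -ln_div//; have := @le_ln1Dx _ (t / y - 1).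
  by rewrite (addrC 1) subrK; apply; rewrite ltrBrDl subrr divr_gt0.
have h1 := ler_wpM2l (_ : 0 <= z - y) (tgt x x0).
have h2 := ler_wpM2l (_ : 0 <= y - x) (tgt z z0).
have {}h1 := h1 (ltW (_ : _)); have {}h2 := h2 (ltW (_ : _)).
rewrite !subr_gt0 in h1 h2; move: (lerD (h1 yz) (h2 xy)).
have -> : (z - y) * (x / y - 1) + (y - x) * (z / y - 1) = 0.
  by field; rewrite gt_eqF.
by lra.
Qed.

(** Logarithms turn the sign of the derivative into the sign of a difference which, for a <= 1 <= b,
    is convex in x. *)
Lemma dbipow_le0 a b x : 0 < a -> 0 < b -> 0 < x < 1 ->
  (dbipow a b x <= 0) = (ln a + (a - 1) * ln x <= ln b + (b - 1) * ln (1 - x)).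
Proof.
move=> a0 b0 /andP[x0 x1]; have y0 : 0 < 1 - x by rewrite subr_gt0.
rewrite /dbipow subr_le0 -ler_ln ?posrE ?mulr_gt0 ?powR_gt0//.
by rewrite !lnM ?posrE ?powR_gt0// !ln_powR.
Qed.

(* The derivative of [bipow] has the sign of a convex function, so it cannot be
   nonpositive, positive and nonpositive at three successive points; as
   [bipow a b 0 = bipow a b 1 = 1], the mean value theorem would produce such
   points. *)
Lemma bipow_cross a b u v : 0 < a <= 1 -> 1 <= b -> 0 < u -> u < v -> v < 1 ->
  bipow a b u <= 1 -> 1 <= bipow a b v -> bipow a b v <= bipow a b u.
Proof.
move=> /andP[a0 a1] b1 u0 uv v1 Ku Kv; rewrite leNgt; apply/negP => Kuv.
have b0 : 0 < b by lra.
have [|x /andP[x0 xu] xE] := @bipow_MVT0 a b u a0;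
  first by rewrite u0 (lt_trans uv).
have [y /andP[uy yv] yE] := bipow_MVT a b u0 uv v1.
(* The interval [v, 1] is reflected to [0, 1 - v], which exchanges the two exponents. *)
have [|w] := @bipow_MVT0 b a (1 - v) b0.
  by apply/andP; split; lra.
have [z ->] : exists z, w = 1 - z by exists (1 - w); rewrite subKr.
rewrite -bipow_sym dbipow_sym => /andP[z1 vz] zE.
have x01 : 0 < x < 1 by lra.
have y01 : 0 < y < 1 by lra.
have z01 : 0 < z < 1 by lra.
have : dbipow a b x <= 0 by rewrite -(pmulr_lle0 _ u0) -xE subr_le0.
have : ~~ (dbipow a b y <= 0).
  by rewrite -ltNge -(pmulr_lgt0 _ (_ : 0 < v - u)) ?subr_gt0// -yE subr_gt0.
have : dbipow a b z <= 0.
  rewrite -oppr_ge0 -(pmulr_lge0 _ (_ : 0 < 1 - v)) ?subr_gt0// -zE.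
  by rewrite subr_ge0.
rewrite !dbipow_le0// -ltNge => hz hy hx.
have x'0 : 0 < x by case/andP: x01.
have xy : x < y by lra.
have yz : y < z by lra.
have l1 := ln_concave x'0 xy yz.
have l2 := @ln_concave (1 - z) (1 - y) (1 - x) _ _ _.
have {}l2 : (y - x) * ln (1 - z) + (z - y) * ln (1 - x) <= (z - x) * ln (1 - y).
  have e1 : 1 - x - (1 - y) = y - x by ring.
  have e2 : 1 - y - (1 - z) = z - y by ring.
  have e3 : 1 - x - (1 - z) = z - x by ring.
  by move: l2; rewrite e1 e2 e3; apply; lra.
move: hx hy hz l1 l2.
move: (ln x) (ln y) (ln z) (ln (1 - x)) (ln (1 - y)) (ln (1 - z)) (ln a) (ln b).
move=> lx ly lz mx my mz la lb hx hy hz l1 l2.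
(* Weights z - y and y - x write (z - x) y as a combination of x and z. The signs at the three
   points ([p1], [p2], [p3]) then contradict convexity ([p4], [p5]). *)
have p1 := ler_wpM2l (ltW (_ : 0 < z - y)) hx.
have p2 := ler_wpM2l (ltW (_ : 0 < y - x)) hz.
have p3 : (z - x) * (lb + (b - 1) * my) < (z - x) * (la + (a - 1) * ly).
  by rewrite ltr_pM2l//; lra.
have p4 : (1 - a) * ((z - y) * lx + (y - x) * lz) <= (1 - a) * ((z - x) * ly).
  by apply: ler_wpM2l => //; lra.
have p5 : (b - 1) * ((y - x) * mz + (z - y) * mx) <= (b - 1) * ((z - x) * my).
  by apply: ler_wpM2l => //; lra.
rewrite !subr_gt0 in p1 p2; have {}p1 := p1 yz; have {}p2 := p2 xy.
by lra.
Qed.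

End PowerInequalities.

(** * Two-point inequalities for powers, and bounds on the logarithm ratios *)

Section TwoPoint.
Variable R : realType.
Implicit Types (a b p q x y z : R).

Lemma powR_two_point_le a p x y : 0 < a <= 1 -> 0 <= p <= 1 -> 0 <= x <= y ->
  ((1 - p) * x + p * y) `^ a <= (1 - p `^ a) * x `^ a + p `^ a * y `^ a.
Proof.
move=> a01 p01 /andP[x0 xy]; have y0 := le_trans x0 xy.
have [p0 p1] : 0 <= p /\ 0 <= 1 - p by case/andP: p01 => ? ?; split; lra.
have h1 : p * x <= p * y by rewrite ler_wpM2l.
have h2 : p * y <= (1 - p) * x + p * y by rewrite lerDr mulr_ge0.
(* The outer pair is [p * x] and the mean, the inner pair [p * y] and [x]; the order of [x] and
   [p * y] is irrelevant. *)
have := powR_majorization_le a01 (mulr_ge0 p0 x0) h1 h2.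
rewrite (_ : p * x + _ - _ = x); last by ring.
by rewrite !powRM//; lra.
Qed.

Lemma powR_two_point_lt a p x y : 0 < a < 1 -> 0 < p < 1 -> 0 < x < y ->
  ((1 - p) * x + p * y) `^ a < (1 - p `^ a) * x `^ a + p `^ a * y `^ a.
Proof.
move=> a01 /andP[p0 p1] /andP[x0 xy]; have y0 := lt_trans x0 xy.
have h1 : p * x < p * y by rewrite ltr_pM2l.
have h2 : p * y < (1 - p) * x + p * y by rewrite ltrDr mulr_gt0// subr_gt0.
have := powR_majorization_lt a01 (mulr_ge0 (ltW p0) (ltW x0)) h1 h2.
rewrite (_ : p * x + _ - _ = x); last by ring.
by rewrite !powRM ?(ltW p0) ?(ltW x0) ?(ltW y0)//; lra.
Qed.

Lemma powR_two_point_ge b p x y : 1 <= b -> 0 <= p <= 1 -> 0 <= x <= y ->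
  (1 - p `^ b) * x `^ b + p `^ b * y `^ b <= ((1 - p) * x + p * y) `^ b.
Proof.
move=> b1 p01 /andP[x0 xy]; have y0 := le_trans x0 xy.
have [p0 p1] : 0 <= p /\ 0 <= 1 - p by case/andP: p01 => ? ?; split; lra.
have h1 : p * x <= p * y by rewrite ler_wpM2l.
have h2 : p * y <= (1 - p) * x + p * y by rewrite lerDr mulr_ge0.
have := powR_majorization_ge b1 (mulr_ge0 p0 x0) h1 h2.
rewrite (_ : p * x + _ - _ = x); last by ring.
by rewrite !powRM//; lra.
Qed.

Lemma powR_log p q : 0 < p < 1 -> 0 < q -> p `^ (ln q / ln p) = q.
Proof.
move=> p01 q0; rewrite /powR gt_eqF; last by case/andP: p01.
by rewrite divfK ?lnK// lt_eqF// ln_lt0.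
Qed.

Lemma log_ratio_le1 p q : 0 < p -> p <= q -> q < 1 -> 0 < ln q / ln p <= 1.
Proof.
move=> p0 pq q1.
have lp : ln p < 0 by rewrite ln_lt0// p0 (le_lt_trans pq).
have lq : ln q < 0 by rewrite ln_lt0// q1 (lt_le_trans p0).
rewrite nmulr_lgt0 ?invr_lt0// lq ler_ndivrMr// mul1r ler_ln ?posrE//.
exact: lt_le_trans pq.
Qed.

Lemma log_ratio_lt1 p q : 0 < p -> p < q -> q < 1 -> 0 < ln q / ln p < 1.
Proof.
move=> p0 pq q1.
have lp : ln p < 0 by rewrite ln_lt0// p0 (lt_trans pq).
have lq : ln q < 0 by rewrite ln_lt0// q1 (lt_trans p0).
rewrite nmulr_lgt0 ?invr_lt0// lq ltr_ndivrMr// mul1r ltr_ln ?posrE//.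
exact: lt_trans pq.
Qed.

Lemma log_ratio_ge1 p q : 0 < p -> p <= q -> q < 1 ->
  1 <= ln (1 - q) / ln (1 - p).
Proof.
move=> p0 pq q1.
have lp : ln (1 - p) < 0 by apply: ln_lt0; lra.
by rewrite ler_ndivlMr// mul1r ler_ln ?posrE; lra.
Qed.

End TwoPoint.

(** * Comparison of the pieces of [Theta], and its two-point inequality *)

Section ThetaTwoPoint.
Variables (R : realType) (p q : R).
Hypotheses (p0 : 0 < p) (pq : p <= q) (q1 : q < 1).
Implicit Types (x y z : R).

Let a := ln q / ln p.
Let b := ln (1 - q) / ln (1 - p).
Let g x := x `^ a.
Let h x : R := 1 - (1 - x) `^ b.

Let p1 : p < 1. Proof. exact: le_lt_trans q1. Qed.
Let q0 : 0 < q. Proof. exact: lt_le_trans pq. Qed.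
Let a01 : 0 < a <= 1. Proof. exact: log_ratio_le1. Qed.
Let b1 : 1 <= b. Proof. exact: log_ratio_ge1. Qed.
Let b0 : b != 0. Proof. by rewrite gt_eqF// (lt_le_trans ltr01). Qed.
Let a0 : a != 0. Proof. by rewrite gt_eqF//; case/andP: a01. Qed.
Let paq : p `^ a = q. Proof. by apply: powR_log; rewrite ?p0. Qed.
Let pbq : (1 - p) `^ b = 1 - q.
Proof. by apply: powR_log; rewrite ?subr_gt0 ?p1 //= ltrBlDr ltrDl. Qed.

Let g_mul x : 0 <= x -> g (p * x) = q * g x.
Proof. by move=> x0; rewrite /g powRM ?(ltW p0)// paq. Qed.

Let g_div x : 0 <= x -> g x = q * g (x / p).
Proof.
move=> x0; rewrite -g_mul ?divr_ge0 ?(ltW p0)//.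
by rewrite mulrCA divff ?mulr1// gt_eqF.
Qed.

(** [bipow a b p = q + (1 - q) = 1]. A value below 1 at some x < p would, by [bipow_cross] between x
    and p, be at least 1. *)
Let h_le_g x : 0 <= x <= p -> h x <= g x.
Proof.
move=> /andP[]; rewrite le_eqVlt => /predU1P[<- _|x0].
  by rewrite /h /g subr0 powR1 subrr powR_ge0.
rewrite le_eqVlt => /predU1P[->|xp]; first by rewrite /h /g paq pbq subKr.
rewrite /h /g lerBlDr leNgt; apply/negP => K1.
have := bipow_cross a01 b1 x0 xp p1 (ltW K1).
by rewrite paq pbq addrC subrK lexx => /(_ isT); rewrite leNgt K1.
Qed.

(** Mirror image of [h_le_g]: a value of [bipow] above 1 at some x > p would be at most its value 1
    at p. *)
Let g_le_h x : p <= x <= 1 -> g x <= h x.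
Proof.
move=> /andP[]; rewrite le_eqVlt => /predU1P[<- _|px].
  by rewrite /h /g paq pbq subKr.
rewrite le_eqVlt => /predU1P[->|x1].
  by rewrite /h /g subrr powR0// powR1 subr0.
rewrite /h /g lerBrDr leNgt; apply/negP => K1.
have := bipow_cross a01 b1 p0 px x1.
by rewrite paq pbq (addrC q) subrK lexx (ltW K1) => /(_ isT isT);
  rewrite leNgt K1.
Qed.

Let ThetaE x : Theta p q x =
  if x <= p ^+ 2 then g x else if x <= p then q * h (x / p) else h x.
Proof. by rewrite /Theta (gt_eqF p0) (lt_eqF p1) (lt_eqF q1). Qed.

Let p2p : p ^+ 2 <= p.
Proof. by rewrite expr2 ger_pMl// ltW. Qed.

Let div_itv x : p ^+ 2 <= x <= p -> p <= x / p <= 1.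
Proof. by rewrite ler_pdivlMr// ler_pdivrMr// mul1r -expr2. Qed.

(** On the middle piece g(x) = q g(x/p) with x/p in [p, 1], so [g_le_h] applies after rescaling. *)
Lemma Theta_ge_pow x : 0 <= x <= 1 -> x `^ (ln q / ln p) <= Theta p q x.
Proof.
rewrite -/a -[x `^ a]/(g x) => /andP[x0 x1]; rewrite ThetaE.
case: (leP x (p ^+ 2)) => // /ltW p2x; case: (leP x p) => [xp|/ltW px];
  last by rewrite g_le_h// px.
by rewrite g_div// ler_pM2l// g_le_h// div_itv// p2x.
Qed.

Let Theta_ge_h x : 0 <= x <= 1 -> h x <= Theta p q x.
Proof.
move=> x01; have [x0 x1] := andP x01; case: (leP x p) => [xp|px].
  by apply: le_trans (Theta_ge_pow x01); rewrite h_le_g// x0.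
by rewrite ThetaE !(leNgt x) px (le_lt_trans p2p px).
Qed.

Let Theta_ge_mid x : 0 <= x <= p -> q * h (x / p) <= Theta p q x.
Proof.
move=> /andP[x0 xp]; rewrite ThetaE xp; case: (leP x (p ^+ 2)) => // xp2.
rewrite g_div// ler_pM2l// h_le_g// divr_ge0 ?(ltW p0)//=.
by rewrite ler_pdivrMr.
Qed.

(** The piece containing the mean [z] is used at x and y too, where [Theta] dominates it. The
    exception is z <= p < y: the middle piece makes no sense at y, and h takes its place there. *)
Lemma Theta_two_point x y : 0 <= x -> x <= y -> y <= 1 ->
  Theta p q ((1 - p) * x + p * y) <= (1 - q) * Theta p q x + q * Theta p q y.
Proof.
move=> x0 xy y1; set z : R := (1 - p) * x + p * y.
have p01 : 0 <= p <= 1 by rewrite !ltW.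
have r0 : 0 < 1 - p by rewrite subr_gt0.
have r01 : 0 <= 1 - p <= 1 by lra.
have xz : x <= z by rewrite /z -subr_ge0 (_ : _ - x = p * (y - x)) ?mulr_ge0
  ?subr_ge0 ?(ltW p0)//; ring.
have zy : z <= y by rewrite /z -subr_ge0 (_ : y - _ = (1 - p) * (y - x))
  ?mulr_ge0 ?subr_ge0 ?(ltW p1)//; ring.
have y0 := le_trans x0 xy; have x1 := le_trans xy y1.
have q1' : 0 <= 1 - q by rewrite subr_ge0 ltW.
have combine s t : s <= Theta p q x -> t <= Theta p q y ->
    (1 - q) * s + q * t <= (1 - q) * Theta p q x + q * Theta p q y.
  by move=> sx ty; rewrite lerD// ler_wpM2l// ltW.
have h_two_point x' y' : 0 <= x' -> x' <= y' -> y' <= 1 ->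
    h ((1 - p) * x' + p * y') <= (1 - q) * h x' + q * h y'.
  move=> x'0 xy' y'1.
  (* Complementing p and both points turns the inequality for t^b into one for h and reverses the
     order of the points. *)
  have := @powR_two_point_ge _ b (1 - p) (1 - y') (1 - x') b1 r01.
  rewrite pbq /h (_ : (1 - (1 - p)) * (1 - y') + (1 - p) * (1 - x') =
    1 - ((1 - p) * x' + p * y')); last by ring.
  have : 0 <= 1 - y' <= 1 - x' by lra.
  by move=> yx /(_ yx); lra.
rewrite [X in X <= _]ThetaE; case: (leP z (p ^+ 2)) => [_|/ltW p2z].
  apply: le_trans (combine (g x) (g y) _ _).
  - have := @powR_two_point_le _ a p x y a01 p01.
    by rewrite paq x0 xy => /(_ isT).
  - by apply: Theta_ge_pow; rewrite x0.
  - by apply: Theta_ge_pow; rewrite y0.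
case: (leP z p) => [zp|_]; last first.
  apply: le_trans (combine (h x) (h y) _ _); first exact: h_two_point.
  - by apply: Theta_ge_h; rewrite x0.
  - by apply: Theta_ge_h; rewrite y0.
have xp := le_trans xz zp.
have xp1 : x / p <= 1 by rewrite ler_pdivrMr// mul1r.
have xp0 : 0 <= x / p by rewrite divr_ge0// ltW.
have Tx := Theta_ge_mid (introT andP (conj x0 xp)).
have [yp|/ltW py] := leP y p.
  apply: le_trans (combine _ _ Tx (Theta_ge_mid _)); last by rewrite y0.
  have yp1 : y / p <= 1 by rewrite ler_pdivrMr// mul1r.
  have xyp : x / p <= y / p by rewrite ler_pM2r ?invr_gt0.
  have := h_two_point _ _ xp0 xyp yp1; rewrite -(ler_pM2l q0).
  rewrite (_ : (1 - p) * (x / p) + p * (y / p) = z / p); last by rewrite /z;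
    ring.
  by lra.
apply: le_trans (combine _ _ Tx (Theta_ge_h _)); last by rewrite y0.
(* Convexity for [s = (1 - y) / (1 - p)] and [u = 1 - x / p]. *)
pose s := (1 - y) / (1 - p); pose u := 1 - x / p.
have s1 : s <= 1 by rewrite ler_pdivrMr//; lra.
have s0 : 0 <= s by rewrite divr_ge0//; lra.
have u0 : 0 <= u by rewrite subr_ge0.
have wE : (1 - p) * (s + u - 1) = 1 - z / p.
  by rewrite /s /u /z; field; rewrite !gt_eqF.
have w0 : 0 <= s + u - 1.
  by rewrite -(pmulr_rge0 _ r0) wE subr_ge0 ler_pdivrMr// mul1r.
have us : s + u - 1 <= s by rewrite /u; lra.
(* The inner pair is [s], [u] and the outer pair [s + u - 1], 1. The factor 1 - q = (1-p)^b then
   turns s^b into (1-y)^b and (s+u-1)^b into (1-z/p)^b. *)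
have := powR_majorization_ge b1 w0 us s1.
rewrite (_ : s + u - 1 + 1 - s = u); last by ring.
have q1'' : 0 < 1 - q by rewrite subr_gt0.
rewrite powR1 -(ler_pM2l q1'') -{1 2}pbq !mulrDr -!powRM ?(ltW r0)//.
rewrite wE (_ : (1 - p) * s = 1 - y);
  last by rewrite /s mulrCA divff ?mulr1// gt_eqF.
rewrite powRM ?(ltW r0)// pbq -(ler_pM2l q0) /h -/u.
by move: (_ `^ b) (_ `^ b) (_ `^ b) => k l m; lra.
Qed.

Lemma Theta0 : Theta p q 0 = 0.
Proof. by rewrite ThetaE exprn_ge0 ?ltW// /g powR0. Qed.

Lemma Theta1 : Theta p q 1 = 1.
Proof.
rewrite ThetaE !leNgt p1 expr_lt1 ?(ltW p0)// p1 /=.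
by rewrite /h subrr powR0// subr0.
Qed.

End ThetaTwoPoint.

(** * Product measures by recursion on coordinates, and the equality case *)

Section CoordinateRecursion.
Variables (R : realType) (T : finType).
Implicit Types (p q : R) (s : seq T) (f g : pred {set T}) (A B D S : {set T}).

(** Recursion on a list of coordinates exposes the two sections of [f] at [i], as the inductions
    require. Coordinates outside [s] count as absent. *)
Fixpoint cube_measure p s f : R :=
  if s is i :: s' then
    (1 - p) * cube_measure p s' f + p * cube_measure p s' (fun B => f (i |: B))
  else (f set0)%:R.

Lemma big_subsetU1 i D (G : {set T} -> R) : i \notin D ->
  \sum_(B : {set T} | B \subset i |: D) G B =
  \sum_(B : {set T} | B \subset D) G B + \sum_(B : {set T} | B \subset D) G (i
    |: B).
Proof.
move=> iD; rewrite (bigID (fun B : {set T} => i \notin B)) /=; congr (_ + _).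
  apply: eq_bigl => B; apply/andP/idP => [[/subsetP BD iB]|BD].
    apply/subsetP => j jB; have := BD _ jB; rewrite !inE => /predU1P[ij|//].
    by rewrite -ij jB in iB.
  split; first exact: subset_trans BD (subsetUr _ _).
  by apply: contraNN iD; apply: subsetP.
rewrite (reindex_onto (fun B : {set T} => i |: B) (fun B => B :\ i)) /=;
  last first.
  by move=> B /andP[_]; rewrite negbK => iB; rewrite setD1K.
apply: eq_bigl => B; rewrite negbK setU11 andbT; apply/andP/idP.
  move=> [/subsetP BD /eqP <-]; apply/subsetP => j; rewrite !inE.
  case/andP => ji jB; have := BD j; rewrite !inE (negPf ji) /=; apply.
  by move: jB; rewrite (negPf ji).
move=> BD; split; first exact: setUS.
by rewrite setU1K//; apply: contraNN iD; apply: subsetP.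
Qed.

Lemma cube_measureE p s f : uniq s -> cube_measure p s f =
  \sum_(B : {set T} | B \subset [set i in s]) (f B)%:R * (p ^+ #|B| * (1 - p)
    ^+ (size s - #|B|)).
Proof.
elim: s f => [|i s IH] f /=.
  move=> _; rewrite (big_pred1 set0) ?cards0 ?expr0 ?mulr1//.
  by move=> B; rewrite set_nil subset0.
move=> /andP[iNs us]; have iD : i \notin [set j in s] by rewrite inE.
rewrite set_cons big_subsetU1// !IH// !mulr_sumr; congr (_ + _).
  apply: eq_bigr => B BD; rewrite subSn; last first.
    by rewrite (leq_trans (subset_leq_card BD))// cardsE card_size.
  by rewrite exprS mulrCA; congr (_ * _); rewrite mulrCA.
apply: eq_bigr => B BD; rewrite cardsU1.
have -> : i \notin B by apply: contraNN iD; apply: subsetP.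
by rewrite add1n subSS exprS mulrCA -!mulrA.
Qed.

(** All weights are positive for 0 < p < 1, so equal measures force equal predicates; the equality
    case relies on this. *)
Lemma cube_measure_leif p s f g : 0 < p < 1 -> uniq s -> (forall B, f B ->
  g B) ->
  cube_measure p s f <= cube_measure p s g
    ?= iff [forall (B : {set T} | B \subset [set i in s]), f B == g B].
Proof.
move=> /andP[p0 p1] us fg; rewrite !cube_measureE//; apply: leif_sum => B _.
have w0 : 0 < p ^+ #|B| * (1 - p) ^+ (size s - #|B|).
  by rewrite mulr_gt0 ?exprn_gt0 ?subr_gt0.
split; first by rewrite ler_pM2r// ler_nat; case: (f B) (fg B) => // ->.
by rewrite (inj_eq (mulIf (lt0r_neq0 w0))) eqr_nat; case: (f B) (g B) => [] [].
Qed.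

Lemma eq_cube_measure p s f g :
  (forall B, B \subset [set i in s] -> f B = g B) ->
  cube_measure p s f = cube_measure p s g.
Proof.
elim: s f g => [|i s IH] f g fg /=; first by rewrite fg// sub0set.
rewrite (IH f g); last by move=> B BD; apply: fg;
  rewrite set_cons (subset_trans BD)// subsetUr.
by congr (_ + _ * _); apply: IH => B BD; apply: fg; rewrite set_cons setUS.
Qed.

Lemma cube_measure_pred0 p s : cube_measure p s pred0 = 0.
Proof. by elim: s => //= i s ->; rewrite !mulr0 addr0. Qed.

Lemma cube_measure_predT p s : cube_measure p s predT = 1.
Proof. by elim: s => //= i s ->; rewrite !mulr1 subrK. Qed.

Lemma cube_measure_itv p s f : 0 < p < 1 -> uniq s ->
  0 <= cube_measure p s f <= 1.
Proof.
move=> p01 us; rewrite -(cube_measure_pred0 p s) -(cube_measure_predT p s).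
by rewrite !(cube_measure_leif p01 us).
Qed.

Definition up_closed f := forall A B, A \subset B -> f A -> f B.

Lemma up_closed_section f i : up_closed f -> up_closed (fun B => f (i |: B)).
Proof. by move=> uf A B AB; apply: uf; rewrite setUS. Qed.

Lemma section_ge p s f i : 0 < p < 1 -> uniq s -> up_closed f ->
  cube_measure p s f <= cube_measure p s (fun B => f (i |: B))
    ?= iff [forall (B : {set T} | B \subset [set j in s]), f B == f (i |: B)].
Proof.
by move=> p01 us uf; apply: cube_measure_leif => // B; apply: uf;
  rewrite subsetUr.
Qed.

Lemma two_point_cube_measure (phi : R -> R) p q s f :
  0 < p < 1 -> 0 < q < 1 -> phi 0 = 0 -> phi 1 = 1 ->
  (forall x y, 0 <= x -> x <= y -> y <= 1 ->
    phi ((1 - p) * x + p * y) <= (1 - q) * phi x + q * phi y) ->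
  uniq s -> up_closed f ->
  phi (cube_measure p s f) <= cube_measure q s f.
Proof.
move=> p01 q01 phi0 phi1 two_point.
elim: s f => [|i s IH] f /=; first by case: (f _) => _ _; rewrite ?phi0 ?phi1.
move=> /andP[_ us] uf; have [q0 q1] := andP q01.
have /andP[x0 _] := cube_measure_itv f p01 us.
have /andP[_ y1] := cube_measure_itv (fun B => f (i |: B)) p01 us.
apply: le_trans (two_point _ _ x0 (section_ge i p01 us uf) y1) _.
apply: lerD; rewrite ler_pM2l ?subr_gt0 ?IH//.
exact: up_closed_section.
Qed.

Lemma cube_measure_subcube p s f S : uniq s -> S \subset [set i in s] ->
  (forall B, B \subset [set i in s] -> f B = (S \subset B)) ->
  cube_measure p s f = p ^+ #|S|.
Proof.
elim: s f S => [|i s IH] f S /=.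
  by rewrite set_nil subset0 => _ /eqP-> ->; rewrite ?sub0set// cards0.
move=> /andP[iNs us]; rewrite set_cons => SD fE.
have iD : i \notin [set j in s] by rewrite inE.
have fE0 B : B \subset [set j in s] -> f B = (S \subset B).
  by move=> BD; apply: fE; rewrite (subset_trans BD)// subsetUr.
have fE1 B : B \subset [set j in s] -> f (i |: B) = (S :\ i \subset B).
  by move=> BD; rewrite fE ?setUS// subDset.
have SiD : S :\ i \subset [set j in s] by rewrite subDset.
rewrite (IH _ _ us SiD fE1); have [iS|iS] := boolP (i \in S).
  rewrite (@eq_cube_measure _ _ _ pred0) => [|B BD]; last first.
    rewrite fE0//=; apply: contraNF iD => /subsetP SB.
    by apply: (subsetP BD); apply: SB.
  by rewrite cube_measure_pred0 mulr0 add0r -exprS (cardsD1 i S) iS.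
have SE : S :\ i = S by apply/setDidPl; rewrite disjoint_sym disjoints1.
by rewrite SE in SiD *; rewrite (IH _ _ us SiD fE0) -mulrDl subrK mul1r.
Qed.

(** Induction on the coordinates: near equality in the two-point inequality decides whether [i]
    belongs to [S], and the hypothesis passes to the section at [i]. *)
Lemma cube_measure_eq_pow p q (a : R) s f :
  0 < p < 1 -> 0 < a < 1 -> p `^ a = q -> uniq s -> up_closed f ->
  cube_measure p s f != 0 ->
  cube_measure q s f <= cube_measure p s f `^ a ->
  exists2 S : {set T}, S \subset [set i in s] &
    forall B, B \subset [set i in s] -> f B = (S \subset B).
Proof.
move=> p01 a01 paq; have [p0 p1] := andP p01; have [a0 a1] := andP a01.
have q0 : 0 < q by rewrite -paq powR_gt0.
have q1 : q < 1.
  have -> : 1 = 1 `^ a :> R by rewrite powR1.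
  by rewrite -paq gt0_ltr_powR// nnegrE ?ltW.
have a01' : 0 < a <= 1 by rewrite a0 ltW.
have p01' : 0 <= p <= 1 by rewrite !ltW.
have q01 : 0 < q < 1 by rewrite q0.
have powle s' f' : uniq s' -> up_closed f' ->
    cube_measure p s' f' `^ a <= cube_measure q s' f'.
  move=> us' uf'; apply: (@two_point_cube_measure (fun x =>
    x `^ a) p q s' f') => //.
  - by rewrite powR0// gt_eqF.
  - by rewrite powR1.
  - by move=> x y x0 xy _; rewrite -paq powR_two_point_le// x0.
elim: s f => [|i s IH] f /=.
  rewrite pnatr_eq0 eqb0 negbK => _ _ f0 _; exists set0; first exact: sub0set.
  by move=> B; rewrite set_nil subset0 => /eqP->; rewrite sub0set.
move=> /andP[iNs us] uf; have uf1 := up_closed_section (i := i) uf.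
have iD : i \notin [set j in s] by rewrite inE.
have sec := section_ge i p01 us uf.
have le0 := powle _ _ us uf; have le1 := powle _ _ us uf1.
have /andP[x0 _] := cube_measure_itv f p01 us.
move: (IH _ us uf1) sec le0 le1 x0.
set x := cube_measure p s f; set y := cube_measure p s _.
set x' := cube_measure q s f; set y' := cube_measure q s _.
move=> IH1 sec le0 le1 x0; rewrite set_cons => xy_neq0 le_xy.
have iNsub B : B \subset [set j in s] -> i \notin B.
  by move=> BD; apply: contraNN iD; apply: subsetP.
have split_i B : B \subset i |: [set j in s] ->
    B \subset [set j in s] \/ exists2 B' : {set T}, B' \subset [set j in s] &
      B = i |: B'.
  move=> BD; have [iB|iB] := boolP (i \in B); [right|left].
    by exists (B :\ i); rewrite ?subDset ?setD1K.
  apply/subsetP => j jB; have := subsetP BD _ jB.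
  by rewrite !inE => /predU1P[ij|//]; rewrite -ij jB in iB.
have nonstrict (S : {set T}) B : i \notin S ->
  (S \subset i |: B) = (S \subset B).
  move=> iS; rewrite -subDset (setDidPl _)//.
  by rewrite disjoint_sym disjoints1.
(* Case x = 0: no member avoids [i], so [i] joins [S]. Since (py)^a = q y^a, the hypothesis descends
   to the section containing [i]. *)
have [xE0|xN0] := eqVneq x 0.
  have fN B : B \subset [set j in s] -> f B = false.
    move=> BD; have f0 (A : {set T}) : pred0 A -> f A by [].
    have [] := cube_measure_leif p01 us f0;
      rewrite cube_measure_pred0 -/x xE0 eqxx => _ /esym/forall_inP.
    by move=> /(_ _ BD)/eqP <-.
  have yN0 : y != 0 by apply: contraNneq xy_neq0 => ->;
    rewrite xE0 !mulr0 addr0.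
  have y0 : 0 <= y by rewrite -xE0; apply: sec.1.
  have [|S SD SE] := IH1 yN0.
    move: le_xy le0; rewrite xE0 mulr0 add0r powR0 ?gt_eqF// powRM ?(ltW p0)//
      paq.
    move=> le_xy le0; rewrite -(ler_pM2l q0); apply: le_trans le_xy.
    by rewrite lerDr mulr_ge0// subr_ge0 ltW.
  exists (i |: S); first exact: setUS.
  move=> B /split_i[BD|[B' BD' ->]].
    by rewrite fN// subUset sub1set (negPf (iNsub _ BD)).
  by rewrite SE// subUset sub1set setU11 nonstrict// iNsub.
(* Case x = y: the two sections agree, so [i] stays out of [S]. The bound y^a <= [x'] leaves [y'] <=
   y^a for the induction. *)
have [xy|xNy] := eqVneq x y.
  have [||S SD SE] := IH1; first by rewrite -xy.
    move: le_xy le0; rewrite xy -mulrDl subrK mul1r => le_xy le0.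
    have h0 : (1 - q) * y `^ a <= (1 - q) * x' by rewrite ler_wpM2l// subr_ge0
      ltW.
    have h1 : q * y `^ a <= q * y' by rewrite ler_wpM2l// ltW.
    by rewrite -(ler_pM2l q0); lra.
  have fE B : B \subset [set j in s] -> f B = f (i |: B).
    move=> BD; case: sec => _; rewrite xy eqxx => /esym/forall_inP.
    by move=> /(_ _ BD)/eqP.
  exists S; first by rewrite (subset_trans SD)// subsetUr.
  have iS : i \notin S by apply: iNsub.
  move=> B /split_i[BD|[B' BD' ->]]; first by rewrite fE// SE.
  by rewrite SE// nonstrict.
(* Case 0 < x < y: the strict two-point inequality contradicts [le_xy]. *)
have x_gt0 : 0 < x by rewrite lt_neqAle eq_sym xN0.
have xy : x < y by rewrite lt_neqAle xNy; apply: sec.1.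
have := powR_two_point_lt a01 p01 (introT andP (conj x_gt0 xy)).
rewrite paq ltNge => /negP[]; apply: le_trans le_xy.
by rewrite lerD// ler_wpM2l ?subr_ge0// ltW.
Qed.

End CoordinateRecursion.

(** * The measure [mu] as a cube measure, and its values at the endpoints *)

Section CubeMeasure.
Variables (R : realType) (n : nat).
Implicit Types (p : R) (F : {set {set 'I_n}}).

Lemma set_enum_ord : [set i in enum 'I_n] = [set: 'I_n].
Proof. by apply/setP => i; rewrite !inE mem_enum. Qed.

Lemma mu_cube_measure p F : mu p F = cube_measure p (enum 'I_n) (fun A =>
  A \in F).
Proof.
rewrite cube_measureE ?enum_uniq// size_enum_ord set_enum_ord /mu big_mkcond.
rewrite [RHS](eq_bigl predT) => [|B]; last by rewrite subsetT.
by apply: eq_bigr => B _; case: (B \in F); rewrite ?mul1r ?mul0r.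
Qed.

Lemma mu_ge0 p F : 0 <= p <= 1 -> 0 <= mu p F.
Proof.
by move=> /andP[p0 p1]; apply: sumr_ge0 => A _;
  rewrite mulr_ge0 ?exprn_ge0 ?subr_ge0.
Qed.

Lemma mu_eq1 p F : F = [set: {set 'I_n}] -> mu p F = 1.
Proof.
move=> ->; rewrite mu_cube_measure -(cube_measure_predT p (enum 'I_n)).
by apply: eq_cube_measure => B _; rewrite inE.
Qed.

(** At p = 0 all the mass sits on [set0], and an increasing family containing [set0] is
    everything. *)
Lemma mu0_gt0 F : increasing F -> 0 < mu (0 : R) F -> F = [set: {set 'I_n}].
Proof.
move=> incF; have [F0 _|F0] := boolP (set0 \in F).
  by apply/setP => A; rewrite inE (incF set0)// sub0set.
rewrite /mu big1 ?ltxx// => A AF;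
  rewrite expr0n cards_eq0 (_ : (A == _) = false) ?mul0r//.
by apply/negbTE; apply: contraNneq F0 => <-.
Qed.

Lemma mu1 F : mu (1 : R) F = ([set: 'I_n] \in F)%:R.
Proof.
rewrite /mu; have muA (A : {set 'I_n}) : A != [set: 'I_n] ->
    (1 : R) ^+ #|A| * (1 - 1) ^+ (n - #|A|) = 0.
  rewrite -properT => /proper_card;
    rewrite cardsT card_ord -subn_gt0 lt0n => An.
  by rewrite subrr expr0n (negPf An) mulr0.
have [TF|TF] := boolP ([set: 'I_n] \in F).
  rewrite (bigD1 [set: 'I_n])//= big1 => [|A /andP[_]]; last exact: muA.
  by rewrite cardsT card_ord subnn expr0 expr1n mulr1 addr0.
by rewrite big1// => A AF; apply: muA; apply: contraNneq TF => <-.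
Qed.

End CubeMeasure.

Lemma mu_increasing_gt0 (R : realType) n (p : R) (F : {set {set 'I_n}}) :
  increasing F -> mu p F != 0 -> [set: 'I_n] \in F.
Proof.
move=> incF; have [->|[A AF] _] := set_0Vmem F;
  first by rewrite /mu big_set0 eqxx.
by apply: incF AF (subsetT _).
Qed.

Theorem theorem1p6 (R : realType) (n : nat) (F : {set {set 'I_n}}) (p q : R)
    (n_ge1 : (1 <= n)%N) (incF : increasing F)
    (p_ge0 : 0 <= p) (le_pq : p <= q) (q_le1 : q <= 1) :
  Theta p q (mu p F) <= mu q F /\
  (0 < p -> p < q -> q < 1 ->
    mu p F `^ (ln q / ln p) <= mu q F /\
    (F <> set0 ->
      (mu q F = mu p F `^ (ln q / ln p) <->
       exists S : {set 'I_n}, F = [set A : {set 'I_n} | S \subset A]))).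
Proof.
have upF : up_closed (fun A => A \in F).
  by move=> A B AB AF; apply: incF AF AB.
have us := enum_uniq 'I_n.
have interior : 0 < p -> q < 1 -> Theta p q (mu p F) <= mu q F.
  move=> p0 q1; have p01 : 0 < p < 1 by rewrite p0 (le_lt_trans le_pq).
  have q01 : 0 < q < 1 by rewrite q1 (lt_le_trans p0).
  rewrite !mu_cube_measure; apply: (two_point_cube_measure p01 q01) => //.
  - exact: Theta0.
  - exact: Theta1.
  - by move=> x y; apply: Theta_two_point.
split.
  (* At the endpoints [Theta] is the identity or the indicator of x > 0. In the latter case positive
     measure at p must force measure 1 at q. *)
  have [q1|qN1] := eqVneq q 1; last first.
    have q1 : q < 1 by rewrite lt_neqAle qN1.
    have [p0|pN0] := eqVneq p 0; last by apply: interior;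
      rewrite // lt_neqAle eq_sym pN0.
    rewrite /Theta p0 eqxx (lt_eqF ltr01)/= orbF.
    have [->//|qN0] := eqVneq q 0.
    case: (ltP 0 (mu 0 F)) => [/mu0_gt0 F1|_];
      last by rewrite mu_ge0// q_le1 (le_trans p_ge0).
    by rewrite mu_eq1// F1.
  rewrite /Theta q1 eqxx andbT oner_eq0 andbF/= orbT.
  have [->//|pN1] := eqVneq p 1.
  rewrite mu1; case: (ltP 0 (mu p F)) =>
    [/lt0r_neq0/(mu_increasing_gt0 incF) ->//|_].
  exact: ler0n.
move=> p0 pq q1; have p01 : 0 < p < 1 by rewrite p0 (lt_trans pq).
have a01 := log_ratio_lt1 p0 pq q1.
have paq : p `^ (ln q / ln p) = q by rewrite powR_log// (lt_trans p0).
have mu01 : 0 <= mu p F <= 1 by rewrite mu_cube_measure cube_measure_itv.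
split; first exact: le_trans (Theta_ge_pow p0 le_pq q1 mu01) (interior p0 q1).
move=> FN0; split=> [muE|[S FE]].
  have muN0 : mu p F != 0.
    have [F0|[A AF]] := set_0Vmem F; first by [].
    rewrite gt_eqF// /mu (bigD1 A)//= ltr_wpDr ?mulr_gt0 ?exprn_gt0 ?subr_gt0
      ?(lt_trans pq)//.
    by apply: sumr_ge0 => B _;
      rewrite mulr_ge0 ?exprn_ge0 ?subr_ge0// ltW// (lt_trans pq).
  have [||S _ SE] := cube_measure_eq_pow p01 a01 paq us upF.
  - by rewrite -mu_cube_measure.
  - by rewrite -!mu_cube_measure muE.
  exists S; apply/setP => A; rewrite inE -SE ?set_enum_ord ?subsetT//.
have muS r : mu r F = r ^+ #|S|.
  rewrite mu_cube_measure; apply: cube_measure_subcube => //;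
    first by rewrite set_enum_ord subsetT.
  by move=> B _; rewrite FE inE.
(* With k = |S|, (p^k)^a = (p^a)^k = q^k. *)
by rewrite !muS -!powR_mulrn ?(ltW p0) ?(le_trans p_ge0)// powRAC paq.
Qed.
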